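(* Let $(M,l,r,\beta)$ be a representation of a Hom-Leibniz conformal algebra $(L,[\cdot_\lambda\cdot],\alpha)$, let $\varphi$ be a $2$-cocycle of $L$ with coefficients in $M$, and let $T:M\to L$ be a $\varphi$-twisted Rota-Baxter operator. Then $(M,\triangleleft_\lambda,\triangleright_\lambda,\vee_\lambda,\beta)$ is a Hom-$NS$-Leibniz conformal algebra, where for $m,n\in M$ $$m\triangleleft_\lambda n=l(T(m))_\lambda n,\qquad m\triangleright_\lambda n=r(m)_\lambda T(n),\qquad m\vee_\lambda n=\varphi_\lambda(T(m),T(n)).$$
   Context: All vector spaces are over $\mathbb C$; $V[\lambda]$ denotes polynomials in $\lambda$ with coefficients in $V$, and linear maps are extended coefficientwise to polynomials. A bilinear map $\circ_\lambda:V\otimes V\to W[\lambda]$ of $\mathbb C[\partial]$-modules is conformal sesqui-linear if $(\partial p)\circ_\lambda q=-\lambda\,p\circ_\lambda q$ and $p\circ_\lambda(\partial q)=(\partial+\lambda)(p\circ_\lambda q)$. A Hom-Leibniz conformal algebra $(L,[\cdot_\lambda\cdot],\alpha)$ is a $\mathbb C[\partial]$-module $L$ with a conformal sesqui-linear map $[\cdot_\lambda\cdot]:L\otimes L\to L[\lambda]$ and a linear map $\alpha:L\to L$ such that for all $p,q,r\in L$: $\alpha\partial=\partial\alpha$; $\alpha[p_\lambda q]=[\alpha(p)_\lambda\alpha(q)]$; $[\alpha(p)_\lambda[q_\mu r]]=[[p_\lambda q]_{\lambda+\mu}\alpha(r)]+[\alpha(q)_\mu[p_\lambda r]]$. A representation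 $(M,l,r,\beta)$ of it is a $\mathbb C[\partial]$-module $M$ with $\mathbb C$-bilinear maps $l:L\otimes M\to M[\lambda]$, $(p,m)\mapsto l(p)_\lambda m$, and $r:M\otimes L\to M[\lambda]$, $(m,p)\mapsto r(m)_\lambda p$, and a linear map $\beta:M\to M$ with $\beta\partial=\partial\beta$, such that for all $p,q\in L$, $m\in M$: $l(\partial p)_\lambda m=-\lambda l(p)_\lambda m$, $l(p)_\lambda(\partial m)=(\partial+\lambda)l(p)_\lambda m$; $r(\partial m)_\lambda p=-\lambda r(m)_\lambda p$, $r(m)_\lambda(\partial p)=(\partial+\lambda)r(m)_\lambda p$; $r(\beta(m))_\lambda([p_\mu q])=r(r(m)_\lambda p)_{\lambda+\mu}\alpha(q)+l(\alpha(p))_\mu(r(m)_\lambda q)$; $r(\beta(m))_\lambda([p_\mu q])=-r(l(p)_\mu m)_{\lambda+\mu}\alpha(q)+l(\alpha(p))_\mu(r(m)_\lambda q)$; $l(\alpha(p))_\lambda(l(q)_\mu m)=l([p_\lambda q])_{\lambda+\mu}\beta(m)+l(\alpha(q))_\mu(l(p)_\lambda m)$; $\beta(l(p)_\lambda m)=l(\alpha(p))_\lambda\beta(m)$, $\beta(r(m)_\lambda p)=r(\beta(m))_\lambda\alpha(p)$. A $2$-cocycle of $L$ with coefficients in $M$ is a conformal sesqui-linear map $\varphi_\lambda:L\otimes L\to M[\lambda]$ with $\varphi_\lambda(\alpha(p),\alpha(q))=\beta(\varphi_\lambda(p,q))$ and, for all $p,q,r\in L$ (in the term $r(\cdot)_{\lambda+\mu}$,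 $r$ is the right action), $$l(\alpha(p))_\lambda\varphi_\mu(q,r)-l(\alpha(q))_\mu\varphi_\lambda(p,r)-r(\varphi_\lambda(p,q))_{\lambda+\mu}\alpha(r)+\varphi_\lambda(\alpha(p),[q_\mu r])-\varphi_\mu(\alpha(q),[p_\lambda r])-\varphi_{\lambda+\mu}([p_\lambda q],\alpha(r))=0.$$ A $\varphi$-twisted Rota-Baxter operator is a $\mathbb C[\partial]$-module homomorphism $T:M\to L$ with $\alpha T=T\beta$ and $[T(m)_\lambda T(n)]=T\bigl(l(T(m))_\lambda n+r(m)_\lambda T(n)+\varphi_\lambda(T(m),T(n))\bigr)$ for all $m,n\in M$. A Hom-$NS$-Leibniz conformal algebra $(A,\triangleleft_\lambda,\triangleright_\lambda,\vee_\lambda,\gamma)$ is a $\mathbb C[\partial]$-module $A$ with conformal sesqui-linear maps $\triangleleft_\lambda,\triangleright_\lambda,\vee_\lambda:A\otimes A\to A[\lambda]$ and a linear map $\gamma:A\to A$ with $\gamma\partial=\partial\gamma$, $\gamma(p\triangleleft_\lambda q)=\gamma(p)\triangleleft_\lambda\gamma(q)$, $\gamma(p\triangleright_\lambda q)=\gamma(p)\triangleright_\lambda\gamma(q)$, $\gamma(p\vee_\lambda q)=\gamma(p)\vee_\lambda\gamma(q)$ such that, writing $p*_\lambda q=p\triangleleft_\lambda q+p\triangleright_\lambda q+p\vee_\lambda q$, for all $p,q,s\in A$: $\gamma(p)\triangleright_\lambda(q*_\mu s)=(p\triangleright_\lambda q)\triangleright_{\lambda+\mu}\gamma(s)+\gamma(q)\triangleleft_\mu(p\triangleright_\lambda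 s)$; $\gamma(p)\triangleleft_\lambda(q\triangleright_\mu s)=(p\triangleleft_\lambda q)\triangleright_{\lambda+\mu}\gamma(s)+\gamma(q)\triangleright_\mu(p*_\lambda s)$; $\gamma(p)\triangleleft_\lambda(q\triangleleft_\mu s)=(p*_\lambda q)\triangleleft_{\lambda+\mu}\gamma(s)+\gamma(q)\triangleleft_\mu(p\triangleleft_\lambda s)$; $\gamma(p)\vee_\lambda(q*_\mu s)-\gamma(q)\vee_\mu(p*_\lambda s)-(p*_\lambda q)\vee_{\lambda+\mu}\gamma(s)+\gamma(p)\triangleleft_\lambda(q\vee_\mu s)-\gamma(q)\triangleleft_\mu(p\vee_\lambda s)-(p\vee_\lambda q)\triangleright_{\lambda+\mu}\gamma(s)=0$. *)

(* Defs.v *)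
From HB Require Import structures.
From mathcomp Require Import all_boot all_order all_algebra finmap.
From mathcomp Require Import reals complex monalg.

Set Implicit Arguments.
Unset Strict Implicit.
Unset Printing Implicit Defensive.

Import GRing.Theory.
Local Open Scope ring_scope.

(** * Polynomials with coefficients in a vector space *)

(* Finitely supported functions I -> V.  V[lambda] is [vpoly nat V];
   V[lambda, mu] is [vpoly (nat * nat)%type V], the index (i, j) standing for
   the monomial lambda^i mu^j.  [{malg V[I]}] already carries an lmodType
   structure when V is a ring (over that ring); the alias allows for the
   coefficientwise one over the base field. *)
Definition vpoly (K : fieldType) (I : choiceType) (V : lmodType K) : Type :=
  {malg V[I]}.
Arguments vpoly {K} I V.

HB.instance Definition _ (K : fieldType) (I : choiceType) (V : lmodType K) :=
  GRing.Zmodule.on (vpoly I V).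

Section VPolyLmodule.
Variables (K : fieldType) (I : choiceType) (V : lmodType K).
Implicit Types (a b : K) (P Q : vpoly I V).

Definition vpoly_scale a P : vpoly I V := [malg k in msupp P => a *: P@_k].

Lemma vpoly_scaleE a P k : (vpoly_scale a P)@_k = a *: P@_k.
Proof. by rewrite mcoeffE; case: msuppP; rewrite ?scaler0. Qed.

Fact vpoly_scaleA a b P :
  vpoly_scale a (vpoly_scale b P) = vpoly_scale (a * b) P.
Proof. by apply/malgP=> k; rewrite !vpoly_scaleE scalerA. Qed.

Fact vpoly_scale1 : left_id 1 vpoly_scale.
Proof. by move=> P; apply/malgP=> k; rewrite vpoly_scaleE scale1r. Qed.

Fact vpoly_scaleDr : right_distributive vpoly_scale +%R.
Proof.
move=> a P Q; apply/malgP=> k.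
by rewrite mcoeffD !vpoly_scaleE mcoeffD scalerDr.
Qed.

Fact vpoly_scaleDl P : {morph vpoly_scale^~ P : a b / a + b}.
Proof.
by move=> a b; apply/malgP=> k; rewrite mcoeffD !vpoly_scaleE scalerDl.
Qed.

HB.instance Definition _ := GRing.Zmodule_isLmodule.Build K (vpoly I V)
  vpoly_scaleA vpoly_scale1 vpoly_scaleDr vpoly_scaleDl.

End VPolyLmodule.

Section VPolyOps.
Variable K : fieldType.
Implicit Types U V W : lmodType K.

(* Coefficientwise extension to V[lambda] of a linear map. *)
Definition vmap V W (f : V -> W) (P : vpoly nat V) : vpoly nat W :=
  \sum_(k <- msupp P) << f P@_k *g k >>.

(* Multiplication by lambda on V[lambda]. *)
Definition mulX V (P : vpoly nat V) : vpoly nat V :=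
  \sum_(k <- msupp P) << P@_k *g k.+1 >>.

(* The scalar ring K[lambda, mu] is {poly {poly K}}: lambda is the inner
   variable and mu the outer one. *)
Definition lam : {poly {poly K}} := 'X%:P.
Definition mu : {poly {poly K}} := 'X.

(* s v in V[lambda, mu], for s in K[lambda, mu] and v in V. *)
Definition tens V (s : {poly {poly K}}) (v : V) : vpoly (nat * nat)%type V :=
  \sum_(j < size s) \sum_(i < size s`_j)
    << s`_j`_i *: v *g (nat_of_ord i, nat_of_ord j) >>.

(* For f_x : V -> W[x] linear and P in V[y], this is f_s(P(t)), that is
     \sum_(k, j) t^k s^j (f P_k)_j  in W[lambda, mu],
   where f is extended coefficientwise to P.  For instance
     [p_lambda [q_mu r]]          is  nest lam (br p) mu (br q r),
     [[p_lambda q]_(lambda+mu) r] is  nest (lam + mu) (br^~ r) lam (br p q). *)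
Definition nest V W (s : {poly {poly K}}) (f : V -> vpoly nat W)
    (t : {poly {poly K}}) (P : vpoly nat V) : vpoly (nat * nat)%type W :=
  \sum_(k <- msupp P) \sum_(j <- msupp (f P@_k))
    tens (t ^+ k * s ^+ j) (f P@_k)@_j.

End VPolyOps.

Arguments lam {K}.
Arguments mu {K}.

(** * Conformal sesqui-linear maps *)

(* A K[d]-module, as a K-vector space with the endomorphism by which d acts. *)
Record cdmodType (K : fieldType) := CDModType {
  cdmod_sort :> lmodType K;
  del : {linear cdmod_sort -> cdmod_sort}
}.
Arguments del {K c}.

Section Conformal.
Variable K : fieldType.
Implicit Types U V W L M A : cdmodType K.

Record conf_sesquilinear U V W (f : U -> V -> vpoly nat W) : Prop := {
  csl_linearl : forall q, linear (f^~ q);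
  csl_linearr : forall p, linear (f p);
  csl_dell : forall p q, f (del p) q = - mulX (f p q);
  csl_delr : forall p q, f p (del q) = vmap del (f p q) + mulX (f p q)
}.

Record hom_Leibniz_conf L (br : L -> L -> vpoly nat L)
    (alpha : {linear L -> L}) : Prop := {
  hlc_sesqui : conf_sesquilinear br;
  hlc_del : forall p, alpha (del p) = del (alpha p);
  hlc_mult : forall p q, vmap alpha (br p q) = br (alpha p) (alpha q);
  hlc_leibniz : forall p q r,
    nest lam (br (alpha p)) mu (br q r) =
      nest (lam + mu) (br^~ (alpha r)) lam (br p q)
      + nest mu (br (alpha q)) lam (br p r)
}.

Record hom_Leibniz_rep L (br : L -> L -> vpoly nat L)
    (alpha : {linear L -> L}) M (l : L -> M -> vpoly nat M)
    (r : M -> L -> vpoly nat M) (beta : {linear M -> M}) : Prop := {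
  hlr_del : forall m, beta (del m) = del (beta m);
  hlr_sesquil : conf_sesquilinear l;
  hlr_sesquir : conf_sesquilinear r;
  hlr_rbr1 : forall p q m,
    nest lam (r (beta m)) mu (br p q) =
      nest (lam + mu) (r^~ (alpha q)) lam (r m p)
      + nest mu (l (alpha p)) lam (r m q);
  hlr_rbr2 : forall p q m,
    nest lam (r (beta m)) mu (br p q) =
      - nest (lam + mu) (r^~ (alpha q)) mu (l p m)
      + nest mu (l (alpha p)) lam (r m q);
  hlr_ll : forall p q m,
    nest lam (l (alpha p)) mu (l q m) =
      nest (lam + mu) (l^~ (beta m)) lam (br p q)
      + nest mu (l (alpha q)) lam (l p m);
  hlr_multl : forall p m, vmap beta (l p m) = l (alpha p) (beta m);
  hlr_multr : forall m p, vmap beta (r m p) = r (beta m) (alpha p)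
}.

Record cocycle2 L (br : L -> L -> vpoly nat L) (alpha : {linear L -> L})
    M (l : L -> M -> vpoly nat M) (r : M -> L -> vpoly nat M)
    (beta : {linear M -> M}) (phi : L -> L -> vpoly nat M) : Prop := {
  coc_sesqui : conf_sesquilinear phi;
  coc_mult : forall p q, phi (alpha p) (alpha q) = vmap beta (phi p q);
  coc_eq : forall p q s,
    nest lam (l (alpha p)) mu (phi q s)
    - nest mu (l (alpha q)) lam (phi p s)
    - nest (lam + mu) (r^~ (alpha s)) lam (phi p q)
    + nest lam (phi (alpha p)) mu (br q s)
    - nest mu (phi (alpha q)) lam (br p s)
    - nest (lam + mu) (phi^~ (alpha s)) lam (br p q) = 0
}.

Record twisted_Rota_Baxter L (br : L -> L -> vpoly nat L)
    (alpha : {linear L -> L}) M (l : L -> M -> vpoly nat M)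
    (r : M -> L -> vpoly nat M) (beta : {linear M -> M})
    (phi : L -> L -> vpoly nat M) (T : {linear M -> L}) : Prop := {
  trb_del : forall m, T (del m) = del (T m);
  trb_hom : forall m, alpha (T m) = T (beta m);
  trb_eq : forall m n,
    br (T m) (T n) = vmap T (l (T m) n + r m (T n) + phi (T m) (T n))
}.

Definition ns_star A (tl tr ve : A -> A -> vpoly nat A) (p q : A) :
    vpoly nat A :=
  tl p q + tr p q + ve p q.

(* [tl], [tr] and [ve] are the products written with a left triangle, a right
   triangle and a vee. *)
Record hom_NS_Leibniz_conf A (tl tr ve : A -> A -> vpoly nat A)
    (gamma : {linear A -> A}) : Prop := {
  ns_sesqui_tl : conf_sesquilinear tl;
  ns_sesqui_tr : conf_sesquilinear tr;
  ns_sesqui_ve : conf_sesquilinear ve;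
  ns_del : forall p, gamma (del p) = del (gamma p);
  ns_mult_tl : forall p q, vmap gamma (tl p q) = tl (gamma p) (gamma q);
  ns_mult_tr : forall p q, vmap gamma (tr p q) = tr (gamma p) (gamma q);
  ns_mult_ve : forall p q, vmap gamma (ve p q) = ve (gamma p) (gamma q);
  ns_eq1 : forall p q s,
    nest lam (tr (gamma p)) mu (ns_star tl tr ve q s) =
      nest (lam + mu) (tr^~ (gamma s)) lam (tr p q)
      + nest mu (tl (gamma q)) lam (tr p s);
  ns_eq2 : forall p q s,
    nest lam (tl (gamma p)) mu (tr q s) =
      nest (lam + mu) (tr^~ (gamma s)) lam (tl p q)
      + nest mu (tr (gamma q)) lam (ns_star tl tr ve p s);
  ns_eq3 : forall p q s,
    nest lam (tl (gamma p)) mu (tl q s) =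
      nest (lam + mu) (tl^~ (gamma s)) lam (ns_star tl tr ve p q)
      + nest mu (tl (gamma q)) lam (tl p s);
  ns_eq4 : forall p q s,
    nest lam (ve (gamma p)) mu (ns_star tl tr ve q s)
    - nest mu (ve (gamma q)) lam (ns_star tl tr ve p s)
    - nest (lam + mu) (ve^~ (gamma s)) lam (ns_star tl tr ve p q)
    + nest lam (tl (gamma p)) mu (ve q s)
    - nest mu (tl (gamma q)) lam (ve p s)
    - nest (lam + mu) (tr^~ (gamma s)) lam (ve p q) = 0
}.

End Conformal.

(* Main.v *)
Require Import Defs.
From HB Require Import structures.
From mathcomp Require Import all_boot all_order all_algebra finmap.
From mathcomp Require Import reals complex monalg.

(** The twisted Rota-Baxter identity says that T carries the total product
    m * n = l(T m) n + r(m) (T n) + phi(T m, T n) of M to the bracket of L: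
    T (m * n) = [T m, T n].  In the NS-Leibniz axioms every product with an
    argument m * n depends on that argument only through its image under T, so
    the bracket [T m, T n] can be put in its place ([nest_vmap], [nest_star]).
    As alpha T = T beta, the four axioms are then read off at elements of the
    form T m: the first from the first compatibility of r with the bracket, the
    second from the other one, the third from the action identity for l, and
    the fourth from the cocycle equation.

    Only the second needs more than this: the compatibility lets r(beta m) act
    at lambda and takes the bracket at mu, whereas in the axiom the product
    with beta m is at mu and the total product at lambda.  The composite
    products are covariant under the exchange of lambda and mu ([nest_swap]),
    so an identity that holds for one order of the variables holds for the
    other. *)

Import GRing.Theory.
Local Open Scope ring_scope.

Section Substitution.
Set Implicit Arguments.
Unset Strict Implicit.
Variable K : fieldType.
Implicit Types U V W : lmodType K.

Lemma linear_fun0 V W (f : V -> W) : linear f -> f 0 = 0.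
Proof. by move=> lf; have := lf (-1) 0 0; rewrite scaler0 add0r scaleN1r addNr. Qed.

Lemma mcoeff_vmap V W (f : V -> W) (P : vpoly nat V) k :
  f 0 = 0 -> (vmap f P)@_k = f P@_k.
Proof.
move=> f0; rewrite raddf_sum /=.
under eq_bigr do rewrite mcoeffU.
have [kP|kP] := boolP (k \in msupp P).
  rewrite (big_fsetD1 k) //= eqxx mulr1n big_seq big1 ?addr0 // => j.
  by rewrite in_fsetD1 => /andP[/negPf-> _].
rewrite (mcoeff_outdom kP) f0 big_seq big1 // => j jP.
by case: eqP => [jk|//]; rewrite jk (negPf kP) in jP.
Qed.

(** Both sides agree term by term, except that the support of T(P) may be
    smaller than that of P; the extra terms on the left come from coefficients
    killed by T and vanish because f 0 = 0. *)
Lemma nest_vmap U V W (s t : {poly {poly K}}) (f : V -> vpoly nat W)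
    (T : U -> V) (P : vpoly nat U) :
  T 0 = 0 -> f 0 = 0 ->
  nest s (fun u => f (T u)) t P = nest s f t (vmap T P).
Proof.
move=> T0 f0; rewrite /nest.
have sub : (msupp (vmap T P) `<=` msupp P)%fset.
  apply/fsubsetP=> k; rewrite -!mcoeff_neq0 mcoeff_vmap //.
  by apply: contraNneq => ->; rewrite T0.
transitivity (\sum_(k <- msupp P) \sum_(j <- msupp (f (vmap T P)@_k))
    tens (t ^+ k * s ^+ j) (f (vmap T P)@_k)@_j).
  by apply: eq_bigr => k _; rewrite mcoeff_vmap.
rewrite -(big_fset_incl _ sub) // => k kP kTP.
by rewrite (mcoeff_outdom kTP) f0 msupp0 big_seq_fset0.
Qed.

End Substitution.

Section Swap.
Set Implicit Arguments.
Unset Strict Implicit.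
Variable K : fieldType.
Implicit Types V W : lmodType K.

Lemma sum_ord_pick (V : zmodType) n (F : nat -> V) i :
  ((n <= i)%N -> F i = 0) -> \sum_(k < n) F k *+ (k == i :> nat) = F i.
Proof.
move=> Fout; have [ni|lt_in] := leqP n i.
  rewrite (Fout ni) big1 // => k _.
  by rewrite ltn_eqF // (leq_trans (ltn_ord k)).
rewrite (bigD1 (Ordinal lt_in)) //= eqxx mulr1n big1 ?addr0 // => k.
by rewrite -val_eqE /= => /negPf->.
Qed.

Lemma mcoeff_tens V (s : {poly {poly K}}) (v : V) i j :
  (tens s v)@_(i, j) = s`_j`_i *: v.
Proof.
have inner (k : nat) :
    (\sum_(h < size s`_k) << s`_k`_h *: v *g (nat_of_ord h, k) >>
      : vpoly _ V)@_(i, j) = s`_k`_i *: v *+ (k == j).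
  rewrite raddf_sum /=.
  under eq_bigr do rewrite mcoeffU xpair_eqE -mulnb mulrnA mulrnAC.
  rewrite (sum_ord_pick (F := fun h => s`_k`_h *: v *+ (k == j))) // => out.
  by rewrite nth_default // scale0r mul0rn.
rewrite raddf_sum /=; under eq_bigr do rewrite inner.
rewrite (sum_ord_pick (F := fun k => s`_k`_i *: v)) // => out.
by rewrite [s`_j]nth_default // coef0 scale0r.
Qed.

Lemma mcoeff_tens_swap V (s : {poly {poly K}}) (v : V) i j :
  (tens (swapXY s) v)@_(i, j) = (tens s v)@_(j, i).
Proof. by rewrite !mcoeff_tens coef_swapXY. Qed.

(** The variables enter a composite product only through the scalar
    t ^+ k * s ^+ j, and the exchange of lambda and mu is a ring morphism. *)
Lemma mcoeff_nest_swap V W (s t : {poly {poly K}}) (f : V -> vpoly nat W)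
    (P : vpoly nat V) i j :
  (nest (swapXY s) f (swapXY t) P)@_(i, j) = (nest s f t P)@_(j, i).
Proof.
rewrite !raddf_sum /=; apply: eq_bigr => k _.
rewrite !raddf_sum /=; apply: eq_bigr => h _.
by rewrite -!rmorphXn -rmorphM mcoeff_tens_swap.
Qed.

Lemma swapXY_lam : swapXY lam = mu :> {poly {poly K}}.
Proof. exact: swapXY_Y. Qed.

Lemma swapXY_mu : swapXY mu = lam :> {poly {poly K}}.
Proof. exact: swapXY_X. Qed.

(** This holds because the exchange of lambda and mu fixes lambda + mu.  The
    signs and variables are those of the second compatibility of r with the
    bracket, where this is used. *)
Lemma nest_swap W V1 V2 V3 (f1 : V1 -> vpoly nat W) (f2 : V2 -> vpoly nat W)
    (f3 : V3 -> vpoly nat W) P1 P2 P3 :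
  nest lam f1 mu P1 = - nest (lam + mu) f2 mu P2 + nest mu f3 lam P3 ->
  nest mu f1 lam P1 = - nest (lam + mu) f2 lam P2 + nest lam f3 mu P3.
Proof.
move=> h; apply/malgP=> -[i j].
have := congr1 (mcoeff (j, i)) h; rewrite !(mcoeffD, mcoeffN).
rewrite -(mcoeff_nest_swap lam mu) -(mcoeff_nest_swap (lam + mu) mu).
rewrite -(mcoeff_nest_swap mu lam) rmorphD /= swapXY_lam swapXY_mu.
by rewrite [mu + lam]addrC.
Qed.

End Swap.

Section Conformal.
Set Implicit Arguments.
Unset Strict Implicit.
Variable K : fieldType.
Implicit Types U V W L M : cdmodType K.

Lemma conf_sesquilinear_comp U U' V V' W (f : U' -> V' -> vpoly nat W)
    (S : {linear U -> U'}) (T : {linear V -> V'}) :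
  (forall u, S (del u) = del (S u)) -> (forall v, T (del v) = del (T v)) ->
  conf_sesquilinear f -> conf_sesquilinear (fun u v => f (S u) (T v)).
Proof.
move=> Sdel Tdel [fl fr fdl fdr]; split=> [v a x y|u a x y|u v|u v] /=.
- by rewrite linearP fl.
- by rewrite linearP fr.
- by rewrite Sdel fdl.
- by rewrite Tdel fdr.
Qed.

Lemma conf_sesquilinear0l U V W (f : U -> V -> vpoly nat W) q :
  conf_sesquilinear f -> f 0 q = 0.
Proof. by move=> hf; apply: (linear_fun0 (csl_linearl hf q)). Qed.

Lemma conf_sesquilinear0r U V W (f : U -> V -> vpoly nat W) p :
  conf_sesquilinear f -> f p 0 = 0.
Proof. by move=> hf; apply: (linear_fun0 (csl_linearr hf p)). Qed.

(** This is the step by which an axiom about the total product of M becomes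
    one about the bracket of L. *)
Lemma nest_star L M W (br : L -> L -> vpoly nat L) (alpha : {linear L -> L})
    (l : L -> M -> vpoly nat M) (r : M -> L -> vpoly nat M)
    (beta : {linear M -> M}) (phi : L -> L -> vpoly nat M)
    (T : {linear M -> L}) (hT : twisted_Rota_Baxter br alpha l r beta phi T)
    (s t : {poly {poly K}}) (f : L -> vpoly nat W) m n :
  f 0 = 0 ->
  nest s (fun u => f (T u)) t
    (ns_star (fun m n => l (T m) n) (fun m n => r m (T n))
       (fun m n => phi (T m) (T n)) m n) =
  nest s f t (br (T m) (T n)).
Proof. by move=> f0; rewrite (trb_eq hT) -nest_vmap // linear0. Qed.

End Conformal.

Theorem proposition5p11 (R : realType) (L M : cdmodType R[i])
    (br : L -> L -> vpoly nat L) (alpha : {linear L -> L})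
    (l : L -> M -> vpoly nat M) (r : M -> L -> vpoly nat M)
    (beta : {linear M -> M}) (phi : L -> L -> vpoly nat M)
    (T : {linear M -> L})
    (hL : hom_Leibniz_conf br alpha)
    (hM : hom_Leibniz_rep br alpha l r beta)
    (hphi : cocycle2 br alpha l r beta phi)
    (hT : twisted_Rota_Baxter br alpha l r beta phi T) :
  hom_NS_Leibniz_conf
    (fun m n : M => l (T m) n)
    (fun m n : M => r m (T n))
    (fun m n : M => phi (T m) (T n))
    beta.
Proof.
have Tdel := trb_del hT.
have aT := trb_hom hT.
have sl := hlr_sesquil hM.
have sr := hlr_sesquir hM.
have sp := coc_sesqui hphi.
split.
- exact: (conf_sesquilinear_comp (T := idfun) Tdel (fun=> erefl) sl).
- exact: (conf_sesquilinear_comp (S := idfun) (fun=> erefl) Tdel sr).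
- exact: (conf_sesquilinear_comp Tdel Tdel sp).
- exact: hlr_del hM.
- by move=> m n; rewrite (hlr_multl hM) aT.
- by move=> m n; rewrite (hlr_multr hM) aT.
- by move=> m n; rewrite -(coc_mult hphi) !aT.
- move=> m n k; rewrite (nest_star hT _ _ _ _ (conf_sesquilinear0r _ sr)).
  by rewrite (hlr_rbr1 hM) !aT.
- move=> m n k; rewrite (nest_star hT _ _ _ _ (conf_sesquilinear0r _ sr)).
  (* The exchanged compatibility brings in the negative of the first term on
     the right, so that the two cancel. *)
  by rewrite (nest_swap (hlr_rbr2 hM _ _ _)) !aT addNKr.
- move=> m n k.
  rewrite (nest_star hT _ _ (f := l^~ (beta k)) _ _ (conf_sesquilinear0l _ sl)).
  by rewrite -!aT (hlr_ll hM).
- move=> m n k.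
  rewrite !(nest_star hT _ _ _ _ (conf_sesquilinear0r _ sp)).
  rewrite (nest_star hT _ _ (f := phi^~ (T (beta k))) _ _ (conf_sesquilinear0l _ sp)).
  rewrite -[RHS](coc_eq hphi (T m) (T n) (T k)) !aT.
  (* The cocycle equation lists the terms in l and r before those in phi. *)
  by rewrite [LHS](ACl (4 * 5 * 6 * 1 * 2 * 3)).
Qed.
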